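(* Let $t=t(n)$ be positive integers with $t(n)=o(\log n)$ as $n\to\infty$. For all sufficiently large $n$ there exist $d\in\mathbb{N}$ and a set $X$ of $n$ points in $\mathbb{R}^d$ such that, with probability $1-o(1)$ over $\Pi\sim\mathcal{J}_{d,t}$, $$\frac{\min_{x'\in X}\sum_{x\in X}\|x-\rho_{\mathrm{span}(x')}(x)\|_2^2}{\min_{x'\in X}\sum_{x\in X}\|\Pi(x)-\rho_{\mathrm{span}(\Pi(x'))}(\Pi(x))\|_2^2}\ \ge\ \frac32-o(1).$$
   Context: $\mathcal{J}_{d,t}$ denotes the distribution of the linear map $\Pi:\mathbb{R}^d\to\mathbb{R}^t$, $x\mapsto Gx$, where $G$ is a $t\times d$ matrix with i.i.d. $\mathcal{N}(0,1/t)$ entries. For a linear subspace $S$, $\rho_S$ denotes orthogonal projection onto $S$. The numerator is the $1$-column subset selection cost of $X$ (best one-dimensional subspace spanned by a point of the set). *)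

(* Defs.v *)
From HB Require Import structures.
From mathcomp Require Import all_boot all_order all_algebra finmap.
From mathcomp Require Import all_classical all_reals all_analysis.

Set Implicit Arguments.
Unset Strict Implicit.
Unset Printing Implicit Defensive.

Import Order.TTheory GRing.Theory Num.Theory.
Import numFieldNormedType.Exports.

Local Open Scope classical_set_scope.
Local Open Scope ring_scope.

Section product_probability.
Local Open Scope ereal_scope.
Context d1 d2 (T1 : measurableType d1) (T2 : measurableType d2) (R : realType).
Variables (P : probability T1 R) (Q : probability T2 R).

Definition product_prob : set (T1 * T2) -> \bar R := P \x Q.

HB.instance Definition _ := Measure.on product_prob.

Let product_prob_setT : product_prob [set: T1 * T2] = 1.
Proof.
rewrite /product_prob -setXTT product_measure1E//=.
by rewrite (probability_setT P) (probability_setT Q) mule1.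
Qed.

HB.instance Definition _ :=
  Measure_isProbability.Build _ _ _ product_prob product_prob_setT.

End product_probability.

Section iid_probability.
Context d (T : measurableType d) (R : realType).

Definition cons_tuple n (p : T * n.-tuple T) : n.+1.-tuple T :=
  [tuple of p.1 :: p.2].

Let measurable_cons_tuple n : measurable_fun [set: T * n.-tuple T] (@cons_tuple n).
Proof. exact: measurable_cons. Qed.

HB.instance Definition _ n :=
  isMeasurableFun.Build _ _ _ _ (@cons_tuple n)
    (@measurable_cons_tuple n).

(* The n-fold product of P with itself: the law of n i.i.d. draws from P. *)
Fixpoint iid_prob (P : probability T R) (n : nat) : probability (n.-tuple T) R :=
  match n with
  | 0 => \d_[tuple]
  | n'.+1 => distribution (product_prob P (iid_prob P n')) (@cons_tuple n')
  end.

Lemma iid_prob_box (P : probability T R) n (A : 'I_n -> set T) :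
  (forall i, measurable (A i)) ->
  iid_prob P n [set w | forall i, A i (tnth w i)] = (\prod_(i < n) P (A i))%E.
Proof.
elim: n A => [|n IH] A mA /=.
  by rewrite big_ord0 diracE mem_set//= => -[].
rewrite big_ord_recl -IH//.
rewrite /distribution/= /pushforward/= /product_prob.
have mB : measurable [set w : n.-tuple T | forall i, A (lift ord0 i) (tnth w i)].
  rewrite (_ : mkset _ =
      \big[setI/setT]_(i < n) ((@tnth n T)^~ i @^-1` A (lift ord0 i))).
    apply: bigsetI_measurable => i _; rewrite -[X in measurable X]setTI.
    exact: measurable_tnth.
  apply/seteqP; split => w /=.
    by move=> h; elim/big_ind : _ => // i _; exact: h.
  move=> h i; move: h; rewrite (bigD1 i)//= => -[]//.
rewrite -product_measure1E//; congr (_ _).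
apply/seteqP; split => -[x w] /=.
  move=> h; split; first by have := h ord0; rewrite tnth0.
  by move=> i; have := h (lift ord0 i); rewrite tnthS.
by move=> [h0 h] i; have [j ->|->] := unliftP ord0 i;
  rewrite ?tnthS ?tnth0//; exact: h.
Qed.

End iid_probability.

Section cost.
Context {R : realType}.

Definition norm2 n (x : 'rV[R]_n) : R := Num.sqrt (\sum_(i < n) x 0 i ^+ 2).

(* Subspaces are row spaces of matrices; [kermx S^T] is the orthogonal
   complement of S for the standard inner product, so [x *m orthoproj S] is the
   orthogonal projection of the row vector x onto S. *)
Definition orthoproj m n (S : 'M[R]_(m, n)) : 'M[R]_n :=
  proj_mx <<S>>%MS (kermx S^T).

Lemma orthoprojP m n (S : 'M[R]_(m, n)) (x : 'rV[R]_n) :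
  (x *m orthoproj S <= S)%MS /\ (x - x *m orthoproj S) *m S^T = 0.
Proof.
have cap0 : (<<S>> :&: kermx S^T)%MS = 0.
  apply/eqP/rowV0P => v; rewrite sub_capmx genmxE.
  move=> /andP[/submxP[u ->]] /sub_kermxP uS.
  have : (u *m S) *m (u *m S)^T = 0 by rewrite trmx_mul mulmxA uS mul0mx.
  move=> /matrixP/(_ 0 0); rewrite !mxE => /eqP; rewrite psumr_eq0; last first.
    by move=> i _; rewrite [X in _ * X]mxE -expr2 sqr_ge0.
  move=> /allP h; apply/rowP => i; have := h i (mem_index_enum _).
  by rewrite [X in _ * X]mxE -expr2 sqrf_eq0 [RHS]mxE => /eqP.
split; first by rewrite (submx_trans (proj_mx_sub _ _ _))// genmxE.
apply/sub_kermxP; apply: proj_mx_compl_sub.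
apply: submx_full.
rewrite /row_full mxrank_disjoint_sum// mxrank_gen mxrank_ker mxrank_tr.
by rewrite subnKC// rank_leq_col.
Qed.

Definition span_cost n (X : {fset 'rV[R]_n}) m (f : 'rV[R]_n -> 'rV[R]_m)
    (x' : 'rV[R]_n) : R :=
  \sum_(x <- X) norm2 (f x - f x *m orthoproj (f x')) ^+ 2.

(* Valued in \bar R so that the quotient of a positive cost by a null one is +oo;
   a null cost does occur (e.g. always when m = 1). The default +oo of the
   minimum is reached only when X is empty. *)
Definition css1_cost n (X : {fset 'rV[R]_n}) m (f : 'rV[R]_n -> 'rV[R]_m) :
    \bar R :=
  \big[Order.min/+oo%E]_(x' <- X) (span_cost X f x')%:E.

Definition tuple_mx t d (w : (t * d)%N.-tuple R) : 'M[R]_(t, d) :=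
  \matrix_(i, j) tnth w (mxvec_index i j).

(* [normal_prob] takes the standard deviation, here sqrt (1 / t). *)
Definition JL_law (d t : nat) (E : set 'M[R]_(t, d)) : \bar R :=
  iid_prob (normal_prob 0 (Num.sqrt t%:R^-1)) (t * d)%N
    [set w | E (tuple_mx w)].

(* Points of R^d are row vectors, so G x reads x *m G^T. *)
Definition mxmap t d (G : 'M[R]_(t, d)) (x : 'rV[R]_d) : 'rV[R]_t := x *m G^T.

End cost.

(* Main.v *)
Require Import Defs.
From HB Require Import structures.
From mathcomp Require Import all_boot all_order all_algebra finmap.
From mathcomp Require Import all_classical all_reals all_analysis.
From mathcomp Require Import measurable_realfun ring lra.

Set Implicit Arguments.
Unset Strict Implicit.
Unset Printing Implicit Defensive.

Import Order.TTheory GRing.Theory Num.Theory.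
Import numFieldNormedType.Exports.

Local Open Scope classical_set_scope.
Local Open Scope ring_scope.

(* Take the n points x_j = 10 e_0 + e_j of R^(n+1), 1 <= j <= n.  They have
   squared norm 101 and pairwise inner products 100, so every choice of x'
   costs 201/101 (n - 1), nearly 2 n.  After projection, with g_j the image of
   e_j, the cost of x_j is at most the sum over k of |g_k - g_j|^2.  A given g_j
   is tiny with probability exp(-O(t)) = n^(-o(1)), so with high probability one
   of the n independent columns is tiny, while a Chernoff bound gives
   sum_k |g_k|^2 <= 6/5 (n + 1).  Hence the projected cost is at most 1.3 n, below
   2/3 of the original one, and eps = 0 works. *)

(** * Integrals of product functions under i.i.d. laws *)

Section iid_integral.
Local Open Scope ereal_scope.
Context d (T : measurableType d) (R : realType) (P : probability T R).

Lemma measurable_prod_tnth (h : T -> R) n : measurable_fun setT h ->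
  measurable_fun setT (fun w : n.-tuple T => \prod_(i < n) h (tnth w i))%R.
Proof.
move=> mh; apply: measurable_prod => i _.
exact: (measurableT_comp mh (measurable_tnth i)).
Qed.

(** Induction on [n]: Tonelli splits off the first coordinate, which contributes one factor [c].
    This makes moment generating functions of sums factor. *)
Lemma integral_iid_prod (h : T -> R) (c : R) n :
  measurable_fun setT h -> (forall x, 0 <= h x)%R ->
  \int[P]_x (h x)%:E = c%:E ->
  \int[iid_prob P n]_w (\prod_(i < n) h (tnth w i))%R%:E = (c ^+ n)%:E.
Proof.
move=> mh h0 hc; elim: n => [|n IH].
  rewrite /= integral_dirac//=; last first.
    by apply/measurable_EFinP; exact: measurable_prod_tnth.
  by rewrite diracT mul1e big_ord0.
have mprod := measurable_prod_tnth (n := n.+1) mh.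
have p0 m (w : m.-tuple T) : (0 <= \prod_(i < m) h (tnth w i))%R.
  exact: prodr_ge0.
rewrite /= ge0_integral_distribution//=.
- rewrite (eq_integral (fun z : T * n.-tuple T =>
    ((h z.1)%:E * (\prod_(i < n) h (tnth z.2 i))%:E))); last first.
    move=> [x w] _; rewrite /= -EFinM big_ord_recl tnth0; congr (_ * _)%:E%R.
    by apply: eq_bigr => i _; rewrite tnthS.
  rewrite /product_prob fubini_tonelli1//=.
  + rewrite /fubini_F/= (eq_integral (fun x => (c ^+ n)%:E * (h x)%:E)).
      rewrite ge0_integralZl//=; first by rewrite hc -EFinM exprSr.
      by apply/measurable_EFinP.
      by move=> x _; rewrite lee_fin.
      rewrite lee_fin exprn_ge0// -lee_fin -hc; apply: integral_ge0 => x _.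
      by rewrite lee_fin.
    move=> x _; rewrite ge0_integralZl//=; last 3 first.
    * by apply/measurable_EFinP; exact: measurable_prod_tnth.
    * by move=> w _; rewrite lee_fin; exact: p0.
    * by rewrite lee_fin.
    by rewrite IH muleC.
  + apply: emeasurable_funM; apply/measurable_EFinP.
      exact: (measurableT_comp mh measurable_fst).
    exact: (measurableT_comp (measurable_prod_tnth mh) measurable_snd).
  + by move=> [x w]; rewrite mule_ge0// lee_fin//; exact: p0.
- by apply/measurable_EFinP.
- by move=> w; rewrite lee_fin; exact: p0.
Qed.

End iid_integral.

(** * Gaussian integrals and small-ball mass *)

Section normal_integral.
Context {R : realType}.
Local Open Scope ereal_scope.
Notation mu := lebesgue_measure.

(** The Radon-Nikodym derivative of the normal law and [normal_pdf] have the same integral over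
    every measurable set, hence agree almost everywhere. *)
Lemma ge0_integral_normal_prob (m s : R) (f : R -> \bar R) :
  measurable_fun setT f -> (forall x, 0 <= f x) ->
  \int[normal_prob m s]_x f x = \int[mu]_x (f x * (normal_pdf m s x)%:E).
Proof.
move=> mf f0.
have dom := normal_prob_dominates m s.
rewrite -(Radon_Nikodym_SigmaFinite.change_of_variables dom)//=.
have mg := measurable_int _ (Radon_Nikodym_SigmaFinite.f_integrable dom).
have mpdf : measurable_fun setT (fun x => (normal_pdf m s x)%:E).
  by apply/measurable_EFinP; exact: measurable_normal_pdf.
apply: ae_eq_integral => //.
- exact: emeasurable_funM.
- exact: emeasurable_funM.
apply: ae_eqe_mul2l; apply: integral_ae_eq => //=.
- exact: Radon_Nikodym_SigmaFinite.f_integrable.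
- by move=> A _ mA; rewrite -Radon_Nikodym_SigmaFinite.f_integral.
Qed.

Lemma normal_peakM (r s : R) : (0 < r)%R ->
  normal_peak (r * s) = (normal_peak s / r)%R.
Proof.
move=> r0; rewrite /normal_peak.
have -> : ((r * s) ^+ 2 * pi *+ 2 = r ^+ 2 * (s ^+ 2 * pi *+ 2))%R by ring.
by rewrite sqrtrM ?sqr_ge0// sqrtr_sqr gtr0_norm// invfM mulrC.
Qed.

(* Tilting the density of N(0, s^2) by this exponential gives, up to the factor
   r, the density of N(0, (r s)^2). *)
Lemma integral_normal_prob_expR_sqr (s r : R) : (0 < s)%R -> (0 < r)%R ->
  \int[normal_prob 0%R s]_x (expR ((1 - r ^- 2) / (s ^+ 2 *+ 2) * x ^+ 2))%:E
    = r%:E.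
Proof.
move=> s0 r0; rewrite ge0_integral_normal_prob; last 2 first.
- apply/measurable_EFinP/measurableT_comp => //.
  by apply: measurable_funM => //; exact: measurable_funX.
- by move=> x; rewrite lee_fin expR_ge0.
have sr0 : (0 < r * s)%R by rewrite mulr_gt0.
transitivity (\int[mu]_x (r%:E * (normal_pdf 0%R (r * s)%R x)%:E)).
  apply: eq_integral => x _; rewrite -!EFinM !normal_pdfE ?gt_eqF//.
  have rK (p f : R) : (r * (p / r * f) = p * f)%R.
    by field; rewrite gt_eqF.
  rewrite normal_peakM// rK mulrCA /normal_fun !subr0 -expRD.
  by congr (_ * expR _)%:E%R; field; rewrite !gt_eqF.
rewrite ge0_integralZl//=.
- by rewrite integral_normal_pdf mule1.
- by apply/measurable_EFinP; exact: measurable_normal_pdf.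
- by move=> x _; rewrite lee_fin normal_pdf_ge0.
- by rewrite lee_fin ltW.
Qed.

(** On the interval the density is at least its value at the endpoints. Length times this value is
    free of [s], so the bound survives the shrinking variance [1 / t]. *)
Lemma le_normal_prob_itv (s c : R) : (0 < s)%R -> (0 <= c)%R ->
  (c *+ 2 * (normal_peak 1 * expR (- (c ^+ 2 / 2))))%:E
    <= normal_prob 0%R s `[(- (c * s))%R, (c * s)%R]%classic.
Proof.
move=> s0 c0.
have -> : ((c *+ 2 * (normal_peak 1 * expR (- (c ^+ 2 / 2))))%:E =
   \int[mu]_(x in `[(- (c * s))%R, (c * s)%R]%classic)
     (normal_peak s * expR (- (c ^+ 2 / 2)))%:E).
  rewrite integral_cst//= lebesgue_measure_itv/= lte_fin.
  have -> : normal_peak s = (normal_peak 1 / s)%R.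
    by rewrite -normal_peakM// mulr1.
  case: ltP => [_|]; rewrite -?EFinB -?EFinM.
    by congr EFin; field; rewrite gt_eqF.
  rewrite mulr0 => cs; congr EFin.
  have : (c * s <= 0)%R by move: cs; rewrite -subr_le0; lra.
  rewrite pmulr_lle0// => cle0.
  have -> : c = 0%R by apply/eqP; rewrite eq_le c0 cle0.
  by rewrite mul0rn mul0r.
rewrite /normal_prob; apply: ge0_le_integral => //=.
- move=> x _; rewrite lee_fin.
  exact: mulr_ge0 (normal_peak_ge0 _) (expR_ge0 _).
- by apply/measurable_funTS/measurable_EFinP; exact: measurable_normal_pdf.
move=> x; rewrite in_itv/= => /andP[x1 x2].
rewrite lee_fin normal_pdfE ?gt_eqF// ler_wpM2l ?normal_peak_ge0//.
rewrite /normal_fun subr0 ler_expR mulNr lerN2.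
rewrite ler_pdivrMr ?pmulrn_lgt0 ?exprn_gt0//.
have -> : (c ^+ 2 / 2 * (s ^+ 2 *+ 2) = (c * s) ^+ 2)%R by field.
by rewrite -subr_ge0 subr_sqr mulr_ge0 ?subr_ge0//; move: x1; lra.
Qed.

End normal_integral.

(** * Independence of the columns of a random matrix *)

Lemma le_measure_bigsetU d (T : measurableType d) (R : realType)
    (mu : {measure set T -> \bar R}) (I : Type)
    (s : seq I) (Q : pred I) (F : I -> set T) :
  (forall i, Q i -> measurable (F i)) ->
  (mu (\big[setU/set0]_(i <- s | Q i) F i) <= \sum_(i <- s | Q i) mu (F i))%E.
Proof.
move=> mF; elim: s => [|i s IH]; first by rewrite !big_nil measure0.
rewrite !big_cons; case: ifP => // Qi.
rewrite (le_trans (measureU2 _ _ _))//; first exact: mF.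
  exact: bigsetU_measurable.
exact: leeD.
Qed.

Section iid_columns.
Local Open Scope ereal_scope.
Context d (T : measurableType d) (R : realType) (P : probability T R).

Lemma iid_prob_mx_box m n (M : 'M[set T]_(m, n)) :
  (forall i j, measurable (M i j)) ->
  iid_prob P (m * n)%N
    [set w | forall i j, M i j (tnth w (mxvec_index i j))] =
  \prod_(j < n) \prod_(i < m) P (M i j).
Proof.
move=> mM; rewrite exchange_big pair_bigA/=.
rewrite (_ : mkset _ = [set w | forall k, mxvec M ord0 k (tnth w k)]).
  rewrite iid_prob_box; last by move=> k; case/mxvec_indexP: k => i j; rewrite mxvecE.
  rewrite (reindex _ (curry_mxvec_bij _ _))/=.
  by apply: eq_bigr => -[i j] _ /=; rewrite mxvecE.
apply/seteqP; split=> w /= h.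
  by move=> k; case/mxvec_indexP: k => i j; rewrite mxvecE.
by move=> i j; have := h (mxvec_index i j); rewrite mxvecE.
Qed.

Lemma measurable_mx_box m n (M : 'M[set T]_(m, n)) :
  (forall i j, measurable (M i j)) ->
  measurable [set w : (m * n)%N.-tuple T |
    forall i j, M i j (tnth w (mxvec_index i j))].
Proof.
move=> mM.
rewrite (_ : mkset _ = \bigcap_(ij in [set: 'I_m * 'I_n])
    ((@tnth _ T)^~ (mxvec_index ij.1 ij.2) @^-1` M ij.1 ij.2)).
  apply: fin_bigcap_measurable => // ij _; rewrite -[X in measurable X]setTI.
  exact: measurable_tnth.
by apply/seteqP; split=> w h => [[i j] _|i j]; [exact: h|exact: (h (i, j))].
Qed.

(* The event is covered by the boxes recording, entry by entry, which side of
   [A] each draw falls on; distributivity of products over sums turns the total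
   mass of the admissible patterns into a product over columns. *)
Lemma iid_prob_no_column_in m n (A : set T) (p : R) :
  measurable A -> P A = p%:E ->
  let E := [set w : (m * n.+1)%N.-tuple T | forall j : 'I_n,
    exists i : 'I_m, ~ A (tnth w (mxvec_index i (lift ord0 j)))] in
  measurable E /\ iid_prob P (m * n.+1)%N E <= ((1 - p ^+ m) ^+ n)%:E.
Proof.
move=> mA PA E.
(* Column 0 will be the image of the common vector [e_0]; it is left unconstrained. *)
pose M (b : {ffun 'I_n -> {ffun 'I_m -> bool}}) : 'M[set T]_(m, n.+1) :=
  \matrix_(i, j) oapp (fun j' => if b j' i then A else ~` A) setT (unlift ord0 j).
pose box b := [set w : (m * n.+1)%N.-tuple T |
  forall i j, M b i j (tnth w (mxvec_index i j))].
pose Q (_ : 'I_n) := [pred g : {ffun 'I_m -> bool} | g != [ffun=> true]].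
have mM b i j : measurable (M b i j).
  rewrite mxE; case: unlift => [j'|]//=.
  by case: ifP => _ //; exact: measurableC.
have -> : E = \big[setU/set0]_(b in family Q) box b.
  rewrite -bigcup_pred; apply/seteqP; split=> w.
    move=> Ew; exists [ffun j : 'I_n => [ffun i : 'I_m =>
      `[< A (tnth w (mxvec_index i (lift ord0 j))) >]]].
      rewrite /=; apply/familyP => j; rewrite inE ffunE.
      have [i nAi] := Ew j; apply/eqP => /ffunP/(_ i); rewrite !ffunE.
      by move/asboolP.
    move=> i j; rewrite mxE; case: unliftP => [j' ->|_]//=.
    by rewrite !ffunE; case: ifPn => /asboolP.
  move=> [b /familyP bQ bw] j; move: (bQ j); rewrite inE => bj.
  have [i bji] : exists i, b j i = false.
    apply/not_existsP => h; move/eqP: bj; apply; apply/ffunP => i.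
    by rewrite ffunE; move: (h i); case: (b j i).
  by exists i; have := bw i (lift ord0 j); rewrite mxE liftK/= bji.
have mbox b : measurable (box b) by exact: measurable_mx_box.
split; first exact: bigsetU_measurable.
rewrite (le_trans (le_measure_bigsetU _ _ _))//.
pose q (b : bool) : R := if b then p else (1 - p)%R.
have Pbox b : iid_prob P (m * n.+1)%N (box b) =
    (\prod_(j < n) \prod_(i < m) q (b j i))%R%:E.
  rewrite iid_prob_mx_box// big_ord_recl big1 => [|i _]; last first.
    by rewrite mxE unlift_none/= probability_setT.
  rewrite mul1e (big_morph EFin EFinM erefl); apply: eq_bigr => j _.
  rewrite (big_morph EFin EFinM erefl); apply: eq_bigr => i _.
  rewrite mxE liftK/= /q; case: (b j i) => //.
  by rewrite probability_setC// PA.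
rewrite (eq_bigr _ (fun b _ => Pbox b)).
rewrite sumEFin -(bigA_distr_big_dep Q (fun _ g => \prod_(i < m) q (g i))%R) lee_fin.
rewrite (eq_bigr (fun=> (1 - p ^+ m)%R)); first by rewrite prodr_const card_ord.
move=> j _; apply/eqP; rewrite eq_sym subr_eq eq_sym; apply/eqP.
(* Over all patterns of one column the masses sum to [(p + (1 - p)) ^ m = 1]; excluding the all-true
   pattern removes [p ^ m]. *)
have e : (\prod_(i < m) \sum_b q b =
    \sum_(g : {ffun 'I_m -> bool}) \prod_(i < m) q (g i))%R.
  exact: bigA_distr_bigA.
rewrite (bigD1 [ffun=> true])//= in e.
rewrite addrC (eq_bigl (fun g : {ffun 'I_m -> bool} => g != [ffun=> true]))//.
transitivity (\prod_(i < m) (\sum_b q b))%R; last first.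
  by rewrite big1// => i _; rewrite big_bool/= /q addrC subrK.
rewrite e; congr (_ + _)%R.
by rewrite (eq_bigr (fun=> p)) ?prodr_const ?card_ord// => i _; rewrite ffunE.
Qed.

End iid_columns.

(** * Chernoff bound for sums of squared Gaussians *)

Section normal_tail.
Context {R : realType}.

Lemma iid_normal_sqr_tail (s r b : R) N : 0 < s -> 1 < r ->
  let E := [set w : N.-tuple (measurableTypeR R) |
    b * N%:R * s ^+ 2 <= \sum_(i < N) tnth w i ^+ 2] in
  measurable E /\
  (iid_prob (normal_prob 0 s) N E
    <= ((r * expR (- ((1 - r ^- 2) / 2 * b))) ^+ N)%:E)%E.
Proof.
move=> s0 r1 E; have r0 : 0 < r by exact: lt_trans r1.
pose f (w : N.-tuple (measurableTypeR R)) : R := \sum_(i < N) tnth w i ^+ 2.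
have mf : measurable_fun setT f.
  apply: measurable_sum => i; apply: measurable_funX.
  exact: (measurable_tnth (T := measurableTypeR R)).
have mE : measurable E.
  by rewrite -[E]setTI; exact: measurable_fun_le.
split=> //.
pose X : {RV iid_prob (normal_prob 0 s) N >-> R} :=
  HB.pack f (isMeasurableFun.Build _ _ _ _ _ mf).
(* With this parameter each squared entry has exponential moment exactly [r]; [1 < r] makes it
   positive, as the Chernoff bound requires. *)
pose l : R := (1 - r ^- 2) / (s ^+ 2 *+ 2).
have l0 : 0 < l.
  rewrite divr_gt0 ?pmulrn_lgt0 ?exprn_gt0// subr_gt0 invf_lt1 ?exprn_gt0//.
  by rewrite exprn_egt1.
have := @chernoff _ _ _ (iid_prob (normal_prob 0 s) N) X l (b * N%:R * s ^+ 2) l0.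
move/le_trans; apply.
rewrite /mmt_gen_fun unlock.
pose h (x : measurableTypeR R) : R := expR (l * x ^+ 2).
have mh : measurable_fun setT h.
  apply: measurableT_comp => //; apply: measurable_funM => //.
rewrite (_ : (\int[_]_w _)%E =
    (\int[iid_prob (normal_prob 0 s) N]_w (\prod_(i < N) h (tnth w i))%:E)%E); last first.
  apply: eq_integral => w _; congr EFin.
  by rewrite /h -expR_sum/= /f mulr_suml; congr expR; apply: eq_bigr => i _; rewrite mulrC.
rewrite (integral_iid_prod _ mh _ (integral_normal_prob_expR_sqr s0 r0)); last first.
  by move=> x; exact: expR_ge0.
rewrite -EFinM lee_fin exprMn -expRM_natl ler_pM2l ?exprn_gt0//.
rewrite ler_expR /l le_eqVlt; apply/orP; left; apply/eqP.
by field; rewrite !gt_eqF.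
Qed.

End normal_tail.

(** * Residuals of projection onto a line *)

Section residual.
Context {R : realType}.

Definition dotv n (x y : 'rV[R]_n) : R := \sum_i x 0 i * y 0 i.

Lemma dotvC n (x y : 'rV[R]_n) : dotv x y = dotv y x.
Proof. by apply: eq_bigr => i _; rewrite mulrC. Qed.

Lemma dotvDl n (x y z : 'rV[R]_n) : dotv (x + y) z = dotv x z + dotv y z.
Proof. by rewrite -big_split; apply: eq_bigr => i _; rewrite mxE mulrDl. Qed.

Lemma dotvZl n (a : R) (x y : 'rV[R]_n) : dotv (a *: x) y = a * dotv x y.
Proof. by rewrite mulr_sumr; apply: eq_bigr => i _; rewrite mxE mulrA. Qed.

Lemma dotv_ge0 n (x : 'rV[R]_n) : 0 <= dotv x x.
Proof. by apply: sumr_ge0 => i _; rewrite -expr2 sqr_ge0. Qed.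

Lemma dotv_eq0 n (x : 'rV[R]_n) : dotv x x = 0 -> x = 0.
Proof.
move/eqP; rewrite psumr_eq0 => [/allP h|i _]; last by rewrite -expr2 sqr_ge0.
apply/rowP => i; have := h i (mem_index_enum _).
by rewrite -expr2 sqrf_eq0 [RHS]mxE => /eqP.
Qed.

Lemma norm2_sqr n (x : 'rV[R]_n) : norm2 x ^+ 2 = dotv x x.
Proof.
rewrite /norm2 sqr_sqrtr; last by apply: sumr_ge0 => i _; exact: sqr_ge0.
by apply: eq_bigr => i _; rewrite expr2.
Qed.

Lemma orthoproj_rV n (x y : 'rV[R]_n) :
  exists2 c, x *m orthoproj y = c *: y & dotv (x - c *: y) y = 0.
Proof.
have [/sub_rVP[c xc] orth] := orthoprojP y x.
exists c => //; move/matrixP/(_ 0 0): orth; rewrite xc !mxE => <-.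
by apply: eq_bigr => i _; rewrite [X in _ = _ * X]mxE.
Qed.

Lemma norm2_residual n (x y : 'rV[R]_n) :
  norm2 (x - x *m orthoproj y) ^+ 2 = dotv x x - dotv x y ^+ 2 / dotv y y.
Proof.
have [c -> orth] := orthoproj_rV x y.
have xy : dotv x y = c * dotv y y.
  by apply/eqP; rewrite -subr_eq0 -mulNr -dotvZl -dotvDl scaleNr orth.
rewrite norm2_sqr dotvC -scaleNr dotvDl dotvZl [dotv y _]dotvC scaleNr orth.
rewrite mulr0 addr0 dotvC -scaleNr dotvDl dotvZl [dotv y x]dotvC xy.
(* The degenerate line [y = 0] fits the formula because division by zero yields zero. *)
have [->|yy0] := eqVneq (dotv y y) 0; first by rewrite !mulr0 expr0n mul0r subr0 addr0.
by field.
Qed.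

(** The vector [y] lies on its own line, and by Pythagoras the projection is the nearest point of
    that line. *)
Lemma norm2_residual_le n (x y : 'rV[R]_n) :
  norm2 (x - x *m orthoproj y) ^+ 2 <= dotv (x - y) (x - y).
Proof.
have [c -> orth] := orthoproj_rV x y; rewrite norm2_sqr.
have -> : x - y = (x - c *: y) + (c - 1) *: y.
  by rewrite scalerBl scale1r addrA subrK.
set u := x - c *: y in orth *.
rewrite dotvDl dotvC dotvDl dotvZl [dotv y u]dotvC orth.
rewrite dotvZl [dotv y _]dotvC dotvDl orth dotvZl.
by rewrite mulr0 addr0 add0r mulrA lerDl mulr_ge0 ?dotv_ge0// -expr2 sqr_ge0.
Qed.

End residual.

(** * The subset selection cost: attainment, ratios and measurability *)

Section css1.
Context {R : realType}.

Lemma span_cost_ge0 n (X : {fset 'rV[R]_n}) m (f : 'rV[R]_n -> 'rV[R]_m) x' :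
  0 <= span_cost X f x'.
Proof. by apply: sumr_ge0 => x _; exact: sqr_ge0. Qed.

Lemma css1_cost_fin n (X : {fset 'rV[R]_n}) m (f : 'rV[R]_n -> 'rV[R]_m) :
  X != fset0 ->
  exists2 v, css1_cost X f = v%:E & exists2 x', x' \in X & v = span_cost X f x'.
Proof.
move=> /fset0Pn[x0]; rewrite /css1_cost -[_ \in X]/(_ \in enum_fset X) => x0X.
have : enum_fset X != [::] by case: (enum_fset X) x0X.
suff : forall s : seq 'rV[R]_n, s != [::] ->
   exists2 v, (\big[Order.min/+oo]_(x' <- s) (span_cost X f x')%:E)%E = v%:E
     & exists2 x', x' \in s & v = span_cost X f x' by apply.
elim=> // x s IH _; rewrite big_cons.
have [->|/IH[v -> [x' x's ->]]] := eqVneq s [::].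
  rewrite big_nil minEle leey; exists (span_cost X f x) => //.
  by exists x; rewrite ?mem_head.
rewrite -EFin_min; exists (Num.min (span_cost X f x) (span_cost X f x')) => //.
rewrite minEle; case: ifP => _; first by exists x; rewrite ?mem_head.
by exists x'; rewrite ?in_cons ?x's ?orbT.
Qed.

Lemma css1_cost_le n (X : {fset 'rV[R]_n}) m (f : 'rV[R]_n -> 'rV[R]_m) x' :
  x' \in X -> (css1_cost X f <= (span_cost X f x')%:E)%E.
Proof. by move=> x'X; apply: ge_bigmin_seq. Qed.

(** This replaces the extended-real quotient by a real inequality for one witness. A null cost gives
    ratio [+oo], consistent with the right side since [C / a] is positive. *)
Lemma css1_ratio_geP n (X : {fset 'rV[R]_n}) m (f : 'rV[R]_n -> 'rV[R]_m)
    (C a : R) : X != fset0 -> 0 < C -> 0 < a ->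
  (a%:E <= C%:E / css1_cost X f)%E <->
  exists2 x', x' \in X & span_cost X f x' <= C / a.
Proof.
move=> X0 C0 a0; have [v vE [x' x'X vx']] := css1_cost_fin f X0.
have v0 : 0 <= v by rewrite vx' span_cost_ge0.
have -> : (a%:E <= C%:E / css1_cost X f)%E = (v <= C / a).
  rewrite vE ler_pdivlMr// /inve; have [->|vn0] := eqVneq v 0.
    by rewrite mulr_infty gtr0_sg// mul1e leey mul0r ltW.
  by rewrite -EFinM lee_fin ler_pdivlMr 1?mulrC// lt_neqAle eq_sym vn0.
split=> [vC|[y yX yC]]; first by exists x' => //; rewrite -vx'.
by rewrite (le_trans _ yC)// -lee_fin -vE; exact: css1_cost_le.
Qed.

Lemma measurable_mxmap_entry t d (x : 'rV[R]_d) i :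
  measurable_fun setT
    (fun w : (t * d)%N.-tuple (measurableTypeR R) => mxmap (tuple_mx w) x 0 i).
Proof.
under eq_fun do rewrite mxE.
apply: measurable_sum => k; apply: measurable_funM => //.
under eq_fun do rewrite !mxE.
exact: (measurable_tnth (T := measurableTypeR R)).
Qed.

Lemma measurable_dotv_mxmap t d (x y : 'rV[R]_d) :
  measurable_fun setT (fun w : (t * d)%N.-tuple (measurableTypeR R) =>
    dotv (mxmap (tuple_mx w) x) (mxmap (tuple_mx w) y)).
Proof.
apply: measurable_sum => k; apply: measurable_funM.
  exact: measurable_mxmap_entry.
exact: measurable_mxmap_entry.
Qed.

(* Clearing the denominator avoids the measurability of inversion; it is
   harmless because where the denominator vanishes so does the numerator. *)
Lemma measurable_span_cost_le t d (X : {fset 'rV[R]_d}) (x' : 'rV[R]_d) (a : R) :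
  measurable [set w : (t * d)%N.-tuple (measurableTypeR R) |
    span_cost X (mxmap (tuple_mx w)) x' <= a].
Proof.
pose W := (t * d)%N.-tuple (measurableTypeR R).
pose f (w : W) := \sum_(x <- X) dotv (mxmap (tuple_mx w) x) (mxmap (tuple_mx w) x).
pose g (w : W) := \sum_(x <- X) dotv (mxmap (tuple_mx w) x) (mxmap (tuple_mx w) x') ^+ 2.
pose h (w : W) := dotv (mxmap (tuple_mx w) x') (mxmap (tuple_mx w) x').
have mf : measurable_fun setT f.
  by apply: measurable_sum => x; exact: measurable_dotv_mxmap.
have mg : measurable_fun setT g.
  apply: measurable_sum => x; apply: measurable_funX.
  exact: measurable_dotv_mxmap.
have mh : measurable_fun setT h by exact: measurable_dotv_mxmap.
have costE w : span_cost X (mxmap (tuple_mx w)) x' = f w - g w / h w.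
  rewrite /f /g mulr_suml -sumrB; apply: eq_bigr => x _.
  exact: norm2_residual.
have h0 w : 0 <= h w by exact: dotv_ge0.
have g0 w : h w = 0 -> g w = 0.
  move/dotv_eq0 => x'0; rewrite /g big1// => x _.
  by rewrite x'0 dotvC -[X in dotv X](scale0r (0 : 'rV_t)) dotvZl mul0r expr0n.
(* Where [h w > 0] the second condition is automatic; where [h w = 0] the first reads [0 <= 0] and
   the second reduces to [f w <= a]. *)
rewrite (_ : mkset _ = [set w | f w * h w - g w <= a * h w] `&`
   ([set w | f w <= a] `|` ~` [set w | h w <= 0])).
  have mle (u v : W -> R) : measurable_fun setT u -> measurable_fun setT v ->
      measurable [set w : W | u w <= v w].
    by move=> mu mv; rewrite -[X in measurable X]setTI; exact: measurable_fun_le.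
  apply: measurableI.
    apply: mle; last exact: measurable_funM.
    by apply: measurable_funB => //; exact: measurable_funM.
  by apply: measurableU; [exact: mle|apply: measurableC; exact: mle].
apply/seteqP; split=> w /=; rewrite costE.
  have [hw0|hw] := eqVneq (h w) 0.
    by rewrite hw0 (g0 _ hw0) mul0r subr0 !mulr0 subr0; split=> //; left.
  have {}hw : 0 < h w by rewrite lt_neqAle eq_sym hw h0.
  move=> le; split; last by right; apply/negP; rewrite -ltNge.
  rewrite -(ler_pM2r hw) in le.
  by rewrite mulrBl divfK ?gt_eqF// in le.
move=> [le1 le2].
have [hw0|hw] := eqVneq (h w) 0.
  by case: le2; rewrite hw0 ?(g0 _ hw0) ?mul0r ?subr0// lexx.
have {}hw : 0 < h w by rewrite lt_neqAle eq_sym hw h0.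
by rewrite -(ler_pM2r hw) mulrBl divfK ?gt_eqF.
Qed.

End css1.

(** * The point set and its costs *)

Section star.
Context {R : realType}.

(** The long common component makes projecting onto the line of one point almost the same as
    subtracting that point; the factor 10 already brings each residual to 201/101, close to 2. *)
Definition star_pt n (j : 'I_n) : 'rV[R]_n.+1 :=
  10 *: delta_mx 0 ord0 + delta_mx 0 (lift ord0 j).

Definition star n : {fset 'rV[R]_n.+1} := [fset star_pt j | j in 'I_n]%fset.

Lemma dotv_star_pt n (i j : 'I_n) :
  dotv (star_pt i) (star_pt j) = 100 + (i == j)%:R.
Proof.
have dE k (y : 'rV[R]_n.+1) : dotv (delta_mx 0 k) y = y 0 k.
  rewrite /dotv (bigD1 k)//= big1 => [|l lk]; rewrite !mxE !eqxx/=.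
    by rewrite mul1r addr0.
  by rewrite (negbTE lk) mul0r.
rewrite dotvDl dotvZl !dE !mxE !eqxx/= (inj_eq lift_inj).
by ring.
Qed.

Lemma star_pt_inj n : injective (@star_pt n).
Proof.
move=> i j ij; apply/eqP; have := dotv_star_pt i j.
rewrite -ij dotv_star_pt eqxx => /addrI/eqP.
by case: (i == j) => //; rewrite oner_eq0.
Qed.

Lemma star_ptP n x : reflect (exists j, x = @star_pt n j) (x \in star n).
Proof.
apply: (iffP (imfsetP _ _ _ _)) => [[j _ ->]|[j ->]]; first by exists j.
by exists j.
Qed.

Lemma card_star n : #|` star n| = n.
Proof.
rewrite card_imfset/=; last exact: star_pt_inj.
by rewrite size_enum_ord.
Qed.

Lemma sum_star n (F : 'rV[R]_n.+1 -> R) :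
  \sum_(x <- star n) F x = \sum_(j < n) F (star_pt j).
Proof.
rewrite big_imfset/=; last by move=> i j _ _; exact: star_pt_inj.
by rewrite big_enum.
Qed.

Lemma span_cost_star n (j : 'I_n) :
  span_cost (star n) id (star_pt j) = 201 / 101 * (n%:R - 1).
Proof.
rewrite /span_cost sum_star.
have termE (i : 'I_n) : norm2 (star_pt i - star_pt i *m orthoproj (star_pt j)) ^+ 2
    = 201 / 101 * (1 - (i == j)%:R).
  rewrite norm2_residual !dotv_star_pt !eqxx.
  by case: (i == j); rewrite /= ?mulr1n ?mulr0n; field.
rewrite (eq_bigr _ (fun i _ => termE i)) -mulr_sumr; congr (_ * _).
rewrite sumrB sumr_const card_ord; congr (_ - _).
by rewrite (bigD1 j)//= eqxx big1 ?addr0// => i /negbTE ->.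
Qed.

Lemma css1_cost_star n : (0 < n)%N ->
  css1_cost (star n) id = (201 / 101 * (n%:R - 1))%:E.
Proof.
case: n => // n _.
have [|v -> [x /star_ptP[j ->] ->]] := css1_cost_fin (X := star n.+1) id.
  by apply/fset0Pn; exists (star_pt ord0); apply/star_ptP; exists ord0.
by rewrite span_cost_star.
Qed.

(** Bounding residuals by differences cancels the common component, leaving columns [k] minus [j].
    Column [j] is tiny, so a lopsided Young inequality puts weight near 1 on column [k]. *)
Lemma span_cost_mxmap_star_le t n (G : 'M[R]_(t, n.+1)) (j : 'I_n) (a b : R) :
  (forall i, G i (lift ord0 j) ^+ 2 <= a) ->
  \sum_i \sum_k G i k ^+ 2 <= b ->
  span_cost (star n) (mxmap G) (star_pt j) <= 21 / 20 * b + 21 * a * t%:R * n%:R.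
Proof.
move=> Ga Gb; rewrite /span_cost sum_star.
apply: (@le_trans _ _ (\sum_(k < n) \sum_(i < t)
    (21 / 20 * G i (lift ord0 k) ^+ 2 + 21 * a))).
  apply: ler_sum => k _; apply: le_trans (norm2_residual_le _ _) _.
  apply: ler_sum => i _; rewrite -mulmxBl /star_pt.
  rewrite opprD addrACA subrr add0r mulmxBl -!rowE !mxE -expr2.
  move: (Ga i) => Gai; set x := G i _; set y := G i _ in Gai *.
  (* One has [21/20 x^2 + 21 y^2 - (x - y)^2 = (x + 20 y)^2 / 20]. *)
  have : 0 <= (x + 20 * y) ^+ 2 by exact: sqr_ge0.
  by rewrite !expr2 in Gai *; nra.
under eq_bigr do rewrite big_split/= -mulr_sumr.
rewrite big_split/= -mulr_sumr; apply: lerD.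
  rewrite ler_pM2l// (le_trans _ Gb)// exchange_big/=; apply: ler_sum => i _.
  by rewrite [leRHS]big_ord_recl lerDr sqr_ge0.
by rewrite !sumr_const !card_ord (mulr_natr _ n) (mulr_natr _ t).
Qed.

End star.

(** * Success probability for fixed [t] and [n] *)

Section star_probability.
Context {R : realType}.

(** Small enough that the tiny column adds only [21 * radius ^+ 2 = 21/1024] per point to the
    cost. *)
Definition radius : R := 1 / 32.

(* A lower bound, uniform in s, for the mass of [-radius s, radius s] under
   N(0, s^2). *)
Definition small_ball : R :=
  radius *+ 2 * (normal_peak 1 * expR (- (radius ^+ 2 / 2))).

(* With l = (1 - (11/10)^-2) / 2 one has E exp(l z^2) = 11/10 for z ~ N(0, 1),
   and the deviation level is 6/5. *)
Definition chernoff_rate : R :=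
  11 / 10 * expR (- ((1 - (11 / 10) ^- 2) / 2 * (6 / 5))).

Lemma radius_gt0 : 0 < radius.
Proof. by rewrite divr_gt0. Qed.

Lemma small_ball_gt0 : 0 < small_ball.
Proof.
rewrite mulr_gt0 ?pmulrn_lgt0 ?radius_gt0// mulr_gt0 ?expR_gt0//.
by rewrite normal_peak_gt0// oner_eq0.
Qed.

Lemma small_ball_le_normal (s : R) : 0 < s ->
  exists2 p, normal_prob 0 s `[- (radius * s), radius * s]%classic = p%:E
    & small_ball <= p <= 1.
Proof.
move=> s0; set A := `[_, _]%classic.
have mA : measurable A by exact: measurable_itv.
have le := le_normal_prob_itv s0 (ltW radius_gt0).
have le1 := probability_le1 (normal_prob 0 s) mA.
have fin : normal_prob 0 s A \is a fin_num by exact: fin_num_measure.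
exists (fine (normal_prob 0 s A)); first by rewrite fineK.
by rewrite -!lee_fin fineK// le le1.
Qed.

Lemma small_ball_le1 : small_ball <= 1.
Proof.
by have [p _ /andP[]] := small_ball_le_normal ltr01; exact: le_trans.
Qed.

Lemma chernoff_rate_gt0 : 0 < chernoff_rate.
Proof. by rewrite mulr_gt0 ?expR_gt0// divr_gt0. Qed.

(** The exponent is [-63/605], and [expR u >= 1 + u] suffices because 63/605 exceeds 1/10. *)
Lemma chernoff_rate_lt1 : chernoff_rate < 1.
Proof.
rewrite /chernoff_rate expRN ltr_pdivrMr ?expR_gt0// mul1r.
apply: lt_le_trans (expR_ge1Dx _).
have -> : (11 / 10) ^- 2 = 100 / 121 :> R by field.
by lra.
Qed.

Lemma sum_sqr_tuple_mx t d (w : (t * d)%N.-tuple R) :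
  \sum_(k < t * d) tnth w k ^+ 2 = \sum_i \sum_j tuple_mx w i j ^+ 2.
Proof.
rewrite (reindex _ (curry_mxvec_bij _ _))/= pair_bigA.
by apply: eq_bigr => -[i j] _; rewrite mxE.
Qed.

(** Union bound over two failures: the total squared norm of the matrix is too large ([E1]), or no
    column past the first has all its entries small ([E2]). *)
Lemma JL_law_star_ge (t n : nat) : (0 < t)%N -> (100 <= n)%N ->
  (JL_law [set G : 'M[R]_(t, n.+1) |
     css1_cost (star n) id / css1_cost (star n) (mxmap G) >= (3 / 2)%:E]
   >= (1 - (chernoff_rate ^+ n + expR (- (n%:R * small_ball ^+ t))))%:E)%E.
Proof.
move=> t0 n100; have n0 : (0 < n)%N by exact: leq_trans n100.
rewrite /JL_law; set s := Num.sqrt _; set E := mkset _.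
pose P := iid_prob (normal_prob 0 s) (t * n.+1)%N.
have tR : 0 < t%:R :> R by rewrite ltr0n.
have nR : 100 <= n%:R :> R by rewrite (ler_nat R 100 n).
have s0 : 0 < s by rewrite sqrtr_gt0 invr_gt0.
have s2 : s ^+ 2 = t%:R^-1 by rewrite sqr_sqrtr// invr_ge0 ltW.
pose C : R := 201 / 101 * (n%:R - 1).
have C0 : 0 < C by rewrite /C mulr_gt0 ?divr_gt0// subr_gt0 (lt_le_trans _ nR)// ltr1n.
have star0 : star (R := R) n != fset0.
  by apply/fset0Pn; exists (star_pt (Ordinal n0)); apply/star_ptP; exists (Ordinal n0).
have EP w : E w <-> exists2 x', x' \in star (R := R) n &
    span_cost (star n) (mxmap (tuple_mx w)) x' <= C / (3 / 2).
  rewrite /E/= css1_cost_star//; apply: css1_ratio_geP => //; exact: divr_gt0.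
have mE : measurable (E : set ((t * n.+1)%N.-tuple (measurableTypeR R))).
  rewrite (_ : E = \bigcup_(x' in [set` star (R := R) n])
     [set w | span_cost (star n) (mxmap (tuple_mx w)) x' <= C / (3 / 2)]).
    apply: fin_bigcup_measurable; first exact: finite_fset.
    by move=> x' _; exact: measurable_span_cost_le.
  by apply/seteqP; split=> w; rewrite EP => -[x' ? ?]; exists x'.
have [|mE1] := @iid_normal_sqr_tail R s (11 / 10) (6 / 5) (t * n.+1)%N s0.
  by lra.
rewrite -/chernoff_rate; set E1 := mkset _ in mE1 *; move=> PE1.
have [p pE /andP[p1 p2]] := small_ball_le_normal s0.
have [mE2] := iid_prob_no_column_in (P := normal_prob 0 s) t n
  (measurable_itv `[- (radius * s), radius * s]) pE.
set E2 := mkset _ in mE2 *; move=> PE2.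
have sub : ~` E `<=` E1 `|` E2.
  move=> w nE; have [E1w|nE1] := pselect (E1 w); first by left.
  have [E2w|nE2] := pselect (E2 w); first by right.
  exfalso; apply: nE; apply/EP.
  have [j Aj] : exists j : 'I_n, forall i : 'I_t,
      `[- (radius * s), radius * s]%classic (tnth w (mxvec_index i (lift ord0 j))).
    apply: contrapT => h; apply: nE2 => j; apply: contrapT => h'.
    by apply: h; exists j => i; apply: contrapT => h''; apply: h'; exists i.
  exists (star_pt j); first by apply/star_ptP; exists j.
  move/negP: nE1; rewrite /E1/= -ltNge => /ltW.
  rewrite sum_sqr_tuple_mx => sumle.
  (* Since [s ^+ 2 = 1 / t], small entries have square at most [radius ^+ 2 / t], and the
     [t * (n + 1)] entries have total square at most [6/5 (n + 1)]. *)
  apply: le_trans (@span_cost_mxmap_star_le _ _ _ (tuple_mx w) j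
    (radius ^+ 2 / t%:R) (6 / 5 * (n%:R + 1)) _ _) _.
  - move=> i; rewrite mxE; have := Aj i; rewrite /= in_itv/= => /andP[a1 a2].
    rewrite -s2 -exprMn -subr_ge0 subr_sqr mulr_ge0 ?subr_ge0//.
    by move: a1; lra.
  - apply: le_trans sumle _; rewrite s2 natrM -natr1 le_eqVlt; apply/orP; left.
    by apply/eqP; field; rewrite gt_eqF.
  have -> : 21 * (radius ^+ 2 / t%:R) * t%:R * n%:R = 21 * radius ^+ 2 * n%:R.
    by field; rewrite gt_eqF.
  (* The claim is [63/50 (n + 1) + 21/1024 n <= 134/101 (n - 1)], which holds for [n >= 100]. *)
  by rewrite /C /radius; lra.
have PnE : (P (~` E) <= (chernoff_rate ^+ n + expR (- (n%:R * small_ball ^+ t)))%:E)%E.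
  apply: (@le_trans _ _ (P (E1 `|` E2))).
    by apply: le_measure; rewrite ?inE//; [exact: measurableC|exact: measurableU].
  apply: le_trans (measureU2 _ mE1 mE2) _; rewrite EFinD; apply: leeD.
    apply: le_trans PE1 _; rewrite lee_fin.
    have q0 := ltW chernoff_rate_gt0; have q1 := ltW chernoff_rate_lt1.
    apply: ler_wiXn2l => //; rewrite (leq_trans (leqnSn n))//.
    by rewrite leq_pmull.
  apply: le_trans PE2 _; rewrite lee_fin.
  have sp : small_ball ^+ t <= p ^+ t.
    by rewrite lerXn2r ?nnegrE// ltW// ?small_ball_gt0// (lt_le_trans small_ball_gt0).
  (* Replace [p] by its lower bound [small_ball], which does not depend on [t], then use
     [1 - x <= exp (- x)]. *)
  apply: (@le_trans _ _ ((1 - small_ball ^+ t) ^+ n)).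
    rewrite lerXn2r ?nnegrE ?subr_ge0 ?exprn_ile1//; last by rewrite lerB.
    - by rewrite (le_trans (ltW small_ball_gt0)).
    - exact: ltW small_ball_gt0.
    - exact: small_ball_le1.
  rewrite -mulrN expRM_natl lerXn2r ?nnegrE ?expR_ge0//.
    by rewrite subr_ge0 exprn_ile1 ?small_ball_le1// ltW// small_ball_gt0.
  by apply: le_trans (expR_ge1Dx _).
have -> : iid_prob (normal_prob 0 s) (t * n.+1) E = (1 - P (~` E))%E.
  by rewrite -probability_setC ?setCK//; exact: measurableC.
by rewrite EFinB leeB.
Qed.

End star_probability.

(** * Asymptotics when [t] is of smaller order than [log n] *)

Theorem theoremA4 (R : realType) (t : nat -> nat)
    (t_gt0 : forall n, (0 < t n)%N)
    (t_o_log : (fun n => (t n)%:R : R^o) =o_\oo (fun n => ln n%:R : R^o)) :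
  exists eps delta : nat -> R,
    [/\ eps @ \oo --> (0 : R), delta @ \oo --> (0 : R) &
      \forall n \near \oo, exists (d : nat) (X : {fset 'rV[R]_d}),
        #|` X| = n /\
        (JL_law [set G : 'M[R]_(t n, d) |
           css1_cost X id / css1_cost X (mxmap G) >= (3 / 2 - eps n)%:E]
         >= (1 - delta n)%:E)%E].
Proof.
(* Here [small_ball ^+ t = exp (- t (L - 1))]; the added 1 guarantees [L > 0], so that [(2 * L)^-1]
   can serve as the little-o constant. *)
pose L : R := 1 - ln small_ball.
have L1 : 1 <= L by rewrite /L lerDl oppr_ge0 ln_le0// small_ball_le1.
have L0 : 0 < L by exact: lt_le_trans L1.
exists (fun=> 0), (fun n => chernoff_rate ^+ n + Num.sqrt n%:R^-1); split.
- exact: cvg_cst.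
- rewrite -[X in _ --> X]addr0; apply: cvgD.
    apply: cvg_expr; rewrite ger0_norm ?chernoff_rate_lt1//.
    exact: ltW chernoff_rate_gt0.
  rewrite -[X in _ --> X]sqrtr0.
  apply: (cvg_comp (fun n => n%:R^-1 : R) Num.sqrt); last exact: sqrt_continuous.
  apply/gtr0_cvgV0; last exact: cvgr_idn.
  by near=> n; rewrite ltr0n; near: n; exists 1%N.
have /eqoP/(_ ((2 * L)^-1)) := t_o_log.
rewrite invr_gt0 mulr_gt0// => /(_ isT) t_small.
near=> n.
have n100 : (100 <= n)%N by near: n; exact: nbhs_infty_ge.
have nR : 1 <= n%:R :> R by rewrite (ler_nat R 1 n); exact: leq_trans n100.
have nR0 : 0 < n%:R :> R by exact: lt_le_trans nR.
have ln0 : 0 <= ln n%:R :> R by exact: ln_ge0.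
have tL : (t n)%:R * L <= ln n%:R / 2.
  have : `|(t n)%:R : R^o| <= (2 * L)^-1 * `|ln n%:R : R^o| by near: n.
  rewrite !ger0_norm// -(ler_pM2r L0) => /le_trans; apply.
  by rewrite le_eqVlt; apply/orP; left; apply/eqP; field; rewrite gt_eqF.
exists n.+1, (star n); split; first exact: card_star.
rewrite subr0; apply: le_trans (JL_law_star_ge (t_gt0 n) n100).
rewrite lee_fin lerB// lerD2l.
have sq : (Num.sqrt n%:R : R) = expR (ln n%:R / 2).
  apply/eqP; rewrite -(eqrXn2 (n := 2))// ?sqrtr_ge0 ?expR_ge0// sqr_sqrtr ?ltW//.
  by rewrite -expRM_natl mulrC divfK// lnK.
(* As [t (L - 1) <= ln n / 2], the factor [small_ball ^+ t] costs at most a square root of [n]. *)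
have mass : Num.sqrt n%:R <= n%:R * small_ball ^+ t n :> R.
  have {1}-> : small_ball = expR (ln small_ball) :> R.
    by rewrite lnK// posrE small_ball_gt0.
  rewrite -expRM_natl -{2}(@lnK _ n%:R)// -expRD sq ler_expR.
  suff : (t n)%:R * (L - 1) <= ln n%:R / 2 by rewrite /L; lra.
  by apply: le_trans tL; rewrite ler_wpM2l// gerBl.
(* After inversion it remains that [sqrt n <= exp y] with [y = n * small_ball ^+ t], which follows
   from [sqrt n <= y <= 1 + y <= exp y]. *)
rewrite expRN (sqrtrV (ltW nR0)) lef_pV2 ?posrE ?expR_gt0 ?sqrtr_gt0//.
apply: le_trans mass _; apply: le_trans (expR_ge1Dx _).
by rewrite lerDr.
Unshelve. all: by end_near.
Qed.
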